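(* Let $\mathbb K$ be a field, let $E\subset\mathrm{ZR}(\mathbb K)$ be non-empty and let $\nu\in\mathrm{ZR}(\mathbb K)$. Then $$\left[\forall\mu\in E,\ \nu\,\boldsymbol{\leq}\,\mu\right]\Longleftrightarrow\nu\,\boldsymbol{\leq}\,\nu_{\inf E}.$$ In particular $\mathrm{ZR}(\mathbb K)$ is a join-semilattice, in the sense of a partially ordered set in which every non-empty subset has an infimum. Moreover, for every $\nu\in\mathrm{ZR}(\mathbb K)$, the set $\{\mu\in\mathrm{ZR}(\mathbb K)\mid\mu\,\boldsymbol{\leq}\,\nu\}$ is totally ordered. The same statements remain valid if $\mathrm{ZR}(\mathbb K)$ is replaced by $\mathrm{ZR}(\mathbb K/\Bbbk)$, where $\Bbbk$ is a subfield of $\mathbb K$.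
   Context: $\mathrm{ZR}(\mathbb K)$ is the set of valuations $\nu:\mathbb K\to\Gamma_\nu\cup\{\infty\}$ on $\mathbb K$ (with $\Gamma_\nu$ a totally ordered abelian group, the trivial valuation being allowed), two valuations being identified when they have the same valuation ring. $V_\nu=\{x\mid\nu(x)\geq0\}$ denotes the valuation ring of $\nu$. $\mathrm{ZR}(\mathbb K/\Bbbk)$ is the subset of valuations trivial on $\Bbbk$ ($\nu(a)=0$ for $a\in\Bbbk\setminus\{0\}$). One writes $\nu_1\,\boldsymbol{\leq}\,\nu_2$ if $\nu_2$ is a composition $\nu_2=\nu_1\circ\nu_3$ with $\nu_3$ a valuation on the residue field of $\nu_1$ (that is, $V_{\nu_2}$ is the inverse image of $V_{\nu_3}$ in $V_{\nu_1}$); equivalently, $V_{\nu_2}\subset V_{\nu_1}$. For non-empty $E\subset\mathrm{ZR}(\mathbb K)$, $\nu_{\inf E}$ denotes the valuation whose valuation ring is the smallest subring of $\mathbb K$ containing $\bigcup_{\mu\in E}V_\mu$ (this subring is a valuation ring of $\mathbb K$, and if $E\subset\mathrm{ZR}(\mathbb K/\Bbbk)$ then $\nu_{\inf E}\in\mathrm{ZR}(\mathbb K/\Bbbk)$). *)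

(* Defs.v *)
From HB Require Import structures.
From mathcomp Require Import all_boot all_order all_algebra.
From mathcomp Require Import generic_quotient ring_quotient.
From mathcomp Require Import boolp classical_sets.

Set Implicit Arguments.
Unset Strict Implicit.
Unset Printing Implicit Defensive.

Import Order.TTheory GRing.Theory Num.Theory.
Local Open Scope ring_scope.
Local Open Scope quotient_scope.
Local Open Scope classical_set_scope.

Record ordAbGroup := OrdAbGroup {
  oag_sort :> porderZmodType;
  oag_total : total (<=%R : rel oag_sort);
  oag_le_transl : forall x y z : oag_sort, x <= y -> z + x <= z + y
}.

(* [option G] stands for the disjoint union of G and {oo}; [None] is oo. *)
Section WithInfinity.
Variable G : ordAbGroup.

Definition addoo (a b : option G) : option G :=
  match a, b with Some x, Some y => Some (x + y) | _, _ => None end.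

Definition leoo (a b : option G) : bool :=
  match a, b with
  | _, None => true
  | None, Some _ => false
  | Some x, Some y => x <= y
  end.

Definition minoo (a b : option G) : option G := if leoo a b then a else b.

End WithInfinity.

Record valuation (K : fieldType) := Valuation {
  vgroup : ordAbGroup;
  vfun :> K -> option vgroup;
  vfun_oo : forall x, vfun x = None <-> x = 0;
  vfunM : forall x y, vfun (x * y) = addoo (vfun x) (vfun y);
  vfunD : forall x y, leoo (minoo (vfun x) (vfun y)) (vfun (x + y))
}.

Section ValuationRing.
Variables (K : fieldType) (nu : valuation K).

Definition vring : {pred K} := [pred x | leoo (Some 0) (nu x)].

Lemma val0 : nu 0 = None. Proof. exact/vfun_oo. Qed.

Lemma val_neq0 x : x != 0 -> exists g, nu x = Some g.
Proof.
case E : (nu x) => [g|] x0; first by exists g.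
by move/vfun_oo/eqP: E; rewrite (negPf x0).
Qed.

Lemma val1 : nu 1 = Some 0.
Proof.
have [g Eg] := val_neq0 (oner_neq0 K).
have := vfunM nu 1 1; rewrite mulr1 Eg /= => -[] /eqP.
by rewrite -subr_eq subrr eq_sym => /eqP ->.
Qed.

Lemma valN x : nu (- x) = nu x.
Proof.
have [g Eg] : exists g, nu (-1) = Some g by apply: val_neq0; rewrite oppr_eq0 oner_neq0.
have g0 : g = 0.
  have := vfunM nu (-1) (-1); rewrite mulrNN mulr1 val1 Eg /= => -[] h.
  have /orP[gge0|gle0] := oag_total 0 g.
    have := oag_le_transl g gge0; rewrite addr0 -h => gle0.
    by apply/le_anti; rewrite gle0 gge0.
  have := oag_le_transl g gle0; rewrite addr0 -h => gge0.
  by apply/le_anti; rewrite gle0 gge0.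
by rewrite -mulN1r vfunM Eg g0; case: (nu x) => //= y; rewrite add0r.
Qed.

Lemma leoo_trans (G : ordAbGroup) (b a c : option G) :
  leoo a b -> leoo b c -> leoo a c.
Proof. by move: a b c => [a|] [b|] [c|] //=; apply: le_trans. Qed.

Lemma leoo_add (G : ordAbGroup) (a b c d : option G) :
  leoo a b -> leoo c d -> leoo (addoo a c) (addoo b d).
Proof.
move: a b c d => [a|] [b|] [c|] [d|] //= ab cd.
apply: le_trans (oag_le_transl b cd).
by rewrite ![_ + c]addrC; apply: oag_le_transl.
Qed.

Lemma leoo_min (G : ordAbGroup) (a b c : option G) :
  leoo a b -> leoo a c -> leoo a (minoo b c).
Proof. by rewrite /minoo; case: ifP. Qed.

Lemma vring_subring : subring_closed vring.
Proof.
split=> [|x y|x y]; rewrite !inE; first by rewrite val1 /=.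
  move=> hx hy; apply: leoo_trans (vfunD nu x (- y)).
  by apply: leoo_min; rewrite ?valN.
by move=> hx hy; rewrite vfunM; move: (leoo_add hx hy); rewrite /= addr0.
Qed.

HB.instance Definition _ := GRing.isSubringClosed.Build K vring vring_subring.

Record vring_type := VringType { vring_val : K; vring_valP : vring_val \in vring }.

HB.instance Definition _ := [isSub for vring_val].
HB.instance Definition _ := [Choice of vring_type by <:].
HB.instance Definition _ := [SubChoice_isSubComNzRing of vring_type by <:].

Definition max_ideal : {pred vring_type} :=
  [pred x | ~~ leoo (nu (val x)) (Some 0)].

Lemma max_idealE x : (x \in max_ideal) = (val x == 0) || ((val x)^-1 \notin vring).
Proof.
rewrite !inE; have [->|x0] := eqVneq; first by rewrite val0.
have [g Eg] := val_neq0 x0.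
have [h Eh] := val_neq0 (invr_neq0 x0).
have := vfunM nu (val x) (val x)^-1; rewrite divff // val1 Eg Eh /= => -[] gh.
congr (~~ _); apply/idP/idP => /=.
  by move/(oag_le_transl h); rewrite addr0 addrC -gh.
by move/(oag_le_transl g); rewrite addr0 -gh.
Qed.

Lemma max_ideal_closed : idealr_closed max_ideal.
Proof.
split; first by rewrite inE raddf0 val0.
  by rewrite inE rmorph1 val1 /= lexx.
move=> a u v.
rewrite !inE => hu hv; rewrite rmorphD rmorphM; apply/negP => h.
have := leoo_trans (vfunD nu _ _) h; rewrite /minoo; case: ifP => _; last first.
  by apply/negP.
rewrite vfunM; apply/negP; apply: contra hu; apply: leoo_trans.
have e : nu (val u) = addoo (Some 0) (nu (val u)).
  by case: (nu (val u)) => //= y; rewrite add0r.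
rewrite {1}e; apply: leoo_add; first by have := valP a; rewrite inE.
by case: (nu (val u)) => //=.
Qed.

HB.instance Definition _ := isIdealr.Build vring_type max_ideal max_ideal_closed.

Definition residue_field := {ideal_quot max_ideal}.

HB.instance Definition _ := GRing.ComNzRing.on residue_field.
HB.instance Definition _ := EqQuotient.on residue_field.

Definition residue (x : vring_type) : residue_field := \pi x.

Definition residue_inv (q : residue_field) : residue_field :=
  residue (insubd 0 (val (repr q))^-1).

Lemma residue_eq0 x : (residue x == 0) = (x \in max_ideal).
Proof. by rewrite -[x in RHS]subr0 Quotient.idealrBE raddf0. Qed.

Lemma residue_mulVf q : q != 0 -> residue_inv q * q = 1.
Proof.
rewrite -{1}[q]reprK residue_eq0 max_idealE negb_or negbK => /andP[q0 qV].
rewrite -{2}[q]reprK /residue_inv /residue -rmorphM -[1](rmorph1 \pi_residue_field).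
by congr (\pi _); apply: val_inj; rewrite rmorphM rmorph1 /= insubdK // mulVf.
Qed.

Lemma residue_inv0 : residue_inv 0 = 0.
Proof.
have : (repr (0 : residue_field)) \in max_ideal by rewrite -residue_eq0 /residue reprK.
rewrite max_idealE /residue_inv => /orP[/eqP->|h]; rewrite ?invr0.
  apply/eqP; rewrite residue_eq0 (_ : insubd _ _ = 0) ?rpred0 //.
  by apply: val_inj; rewrite insubdK ?rpred0 ?raddf0.
apply/eqP; rewrite residue_eq0 (_ : insubd _ _ = 0) ?rpred0 //.
by rewrite /insubd insubN.
Qed.

HB.instance Definition _ :=
  GRing.ComNzRing_isField.Build residue_field residue_mulVf residue_inv0.

End ValuationRing.

Definition is_subring (K : fieldType) (A : set K) : Prop :=
  A 1 /\ forall x y, A x -> A y -> A (x - y) /\ A (x * y).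

(* Any subring W of K containing x or x^-1 for every x is the valuation ring of
   a valuation, with value group K^* / W^*. *)
Section ValuationOfSubring.

Record valuation_subring (K : fieldType) := ValuationSubring {
  vs_set :> K -> Prop;
  vs_subring : is_subring vs_set;
  vs_inv : forall x, vs_set x \/ vs_set x^-1
}.

Variables (K : fieldType) (W : valuation_subring K).

Lemma vs1 : W 1. Proof. by case: (vs_subring W). Qed.

Lemma vsB x y : W x -> W y -> W (x - y).
Proof. by case: (vs_subring W) => _ h /h{}h /h[]. Qed.

Lemma vsM x y : W x -> W y -> W (x * y).
Proof. by case: (vs_subring W) => _ h /h{}h /h[]. Qed.

Lemma vs0 : W 0. Proof. by rewrite -(subrr 1); apply: vsB vs1 vs1. Qed.

Lemma vsD x y : W x -> W y -> W (x + y).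
Proof. by move=> hx hy; rewrite -[y]opprK -[- y]sub0r; do 2?[apply: vsB => //]; exact: vs0. Qed.

Definition vs_dvd (x y : {x : K | x != 0}) : bool := `[< W (val y / val x) >].

Lemma vs_dvd_refl : reflexive vs_dvd.
Proof. by move=> x; apply/asboolP; rewrite divff ?(valP x) //; apply: vs1. Qed.

Lemma vs_dvd_trans : transitive vs_dvd.
Proof.
move=> y x z /asboolP xy /asboolP yz; apply/asboolP.
by have := vsM yz xy; rewrite mulrA mulfVK ?(valP y).
Qed.

Lemma vs_dvd_total : total vs_dvd.
Proof.
move=> x y; apply/orP; case: (vs_inv W (val y / val x)) => h.
  by left; apply/asboolP.
by right; apply/asboolP; rewrite -invf_div.
Qed.

Definition vs_eqv : rel {x : K | x != 0} := fun x y => vs_dvd x y && vs_dvd y x.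

Lemma vs_eqv_refl : reflexive vs_eqv.
Proof. by move=> x; rewrite /vs_eqv vs_dvd_refl. Qed.

Lemma vs_eqv_sym : symmetric vs_eqv.
Proof. by move=> x y; rewrite /vs_eqv andbC. Qed.

Lemma vs_eqv_trans : transitive vs_eqv.
Proof.
move=> y x z /andP[xy yx] /andP[yz zy].
by rewrite /vs_eqv (vs_dvd_trans xy yz) (vs_dvd_trans zy yx).
Qed.

Canonical vs_eqv_equiv := EquivRel vs_eqv vs_eqv_refl vs_eqv_sym vs_eqv_trans.

Definition vs_group := {eq_quot vs_eqv}.
HB.instance Definition _ := Choice.on vs_group.
HB.instance Definition _ := EqQuotient.on vs_group.

Definition nz1 : {x : K | x != 0} := exist _ 1 (oner_neq0 K).
Definition nzM (x y : {x : K | x != 0}) : {x : K | x != 0} :=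
  exist _ (val x * val y) (mulf_neq0 (valP x) (valP y)).
Definition nzV (x : {x : K | x != 0}) : {x : K | x != 0} :=
  exist _ (val x)^-1 (invr_neq0 (valP x)).

Lemma vs_dvdM x y z t : vs_dvd x y -> vs_dvd z t -> vs_dvd (nzM x z) (nzM y t).
Proof.
move=> /asboolP h1 /asboolP h2; apply/asboolP => /=.
by rewrite -mulf_div; apply: vsM.
Qed.

Lemma vs_dvdV x y : vs_dvd (nzV x) (nzV y) = vs_dvd y x.
Proof. by rewrite /vs_dvd /= invrK mulrC. Qed.

Definition vs_cls (x : {x : K | x != 0}) : vs_group := \pi x.
Definition vs_add (a b : vs_group) : vs_group := vs_cls (nzM (repr a) (repr b)).
Definition vs_opp (a : vs_group) : vs_group := vs_cls (nzV (repr a)).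
Definition vs_le (a b : vs_group) : bool := vs_dvd (repr a) (repr b).

Lemma vs_clsK a : vs_cls (repr a) = a. Proof. exact: reprK. Qed.

Lemma vs_cls_eq x y : vs_cls x = vs_cls y <-> vs_eqv x y.
Proof. by split=> [/eqP|h]; [rewrite /vs_cls piE | apply/eqP; rewrite /vs_cls piE]. Qed.

Lemma vs_repr x : vs_eqv (repr (vs_cls x)) x.
Proof. by apply/vs_cls_eq; rewrite vs_clsK. Qed.

Lemma vs_clsM x y : vs_add (vs_cls x) (vs_cls y) = vs_cls (nzM x y).
Proof.
apply/vs_cls_eq; have /andP[x1 x2] := vs_repr x; have /andP[y1 y2] := vs_repr y.
by rewrite /vs_eqv !vs_dvdM.
Qed.

Lemma vs_clsV x : vs_opp (vs_cls x) = vs_cls (nzV x).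
Proof.
by apply/vs_cls_eq; rewrite /vs_eqv !vs_dvdV andbC; exact: vs_repr.
Qed.

Lemma vs_le_cls x y : vs_le (vs_cls x) (vs_cls y) = vs_dvd x y.
Proof.
have /andP[x1 x2] := vs_repr x; have /andP[y1 y2] := vs_repr y.
apply/idP/idP => h; first exact: vs_dvd_trans x2 (vs_dvd_trans h y1).
exact: vs_dvd_trans x1 (vs_dvd_trans h y2).
Qed.

Lemma vs_addA : associative vs_add.
Proof.
move=> a b c; rewrite -[a]vs_clsK -[b]vs_clsK -[c]vs_clsK !vs_clsM.
by congr vs_cls; apply: val_inj; rewrite /= mulrA.
Qed.

Lemma vs_addC : commutative vs_add.
Proof.
move=> a b; rewrite -[a]vs_clsK -[b]vs_clsK !vs_clsM.
by congr vs_cls; apply: val_inj; rewrite /= mulrC.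
Qed.

Lemma vs_add0 : left_id (vs_cls nz1) vs_add.
Proof.
move=> a; rewrite -[a]vs_clsK !vs_clsM.
by congr vs_cls; apply: val_inj; rewrite /= mul1r.
Qed.

Lemma vs_addN : left_inverse (vs_cls nz1) vs_opp vs_add.
Proof.
move=> a; rewrite -[a]vs_clsK vs_clsV !vs_clsM.
by congr vs_cls; apply: val_inj; rewrite /= mulVf ?(valP (repr a)).
Qed.

Lemma vs_le_refl : reflexive vs_le.
Proof. by move=> a; apply: vs_dvd_refl. Qed.

Lemma vs_le_anti : antisymmetric vs_le.
Proof. by move=> a b h; rewrite -[a]vs_clsK -[b]vs_clsK; apply/vs_cls_eq. Qed.

Lemma vs_le_trans : transitive vs_le.
Proof. by move=> b a c; apply: vs_dvd_trans. Qed.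

HB.instance Definition _ :=
  GRing.isZmodule.Build vs_group vs_addA vs_addC vs_add0 vs_addN.
HB.instance Definition _ :=
  Order.Le_isPOrder.Build ring_display vs_group vs_le_refl vs_le_anti vs_le_trans.

Lemma vs_le_transl (a b c : vs_group) : a <= b -> c + a <= c + b.
Proof.
move=> h; rewrite -[a]vs_clsK -[b]vs_clsK -[c]vs_clsK.
rewrite /GRing.add /= !vs_clsM [_ <= _]vs_le_cls vs_dvdM ?vs_dvd_refl //.
Qed.

Lemma vs_le_total : total (<=%R : rel vs_group).
Proof. by move=> a b; apply: vs_dvd_total. Qed.

Definition vs_ordgroup : ordAbGroup := OrdAbGroup vs_le_total vs_le_transl.

Definition vs_val (x : K) : option vs_ordgroup := omap vs_cls (insub x).

Lemma vs_val_oo x : vs_val x = None <-> x = 0.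
Proof.
rewrite /vs_val; case: insubP => [u ux <-|/negPn/eqP->] //=.
by split=> // u0; case/eqP: (valP u).
Qed.

Lemma vs_valE (x : {x : K | x != 0}) : vs_val (val x) = Some (vs_cls x).
Proof. by rewrite /vs_val valK. Qed.

Lemma vs_val0 : vs_val 0 = None. Proof. exact/vs_val_oo. Qed.

Lemma vs_valM x y : vs_val (x * y) = addoo (vs_val x) (vs_val y).
Proof.
have [->|x0] := eqVneq x 0; first by rewrite mul0r vs_val0.
have [->|y0] := eqVneq y 0; first by rewrite mulr0 vs_val0; case: (vs_val x).
rewrite -[x]/(val (exist _ x x0 : {x : K | x != 0})).
rewrite -[y]/(val (exist _ y y0 : {x : K | x != 0})).
rewrite -[_ * _]/(val (nzM (exist _ x x0) (exist _ y y0))) !vs_valE /=.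
by congr Some; rewrite -vs_clsM.
Qed.

Lemma vs_val_le x y : y != 0 -> leoo (vs_val y) (vs_val x) <-> W (x / y).
Proof.
move=> y0; have [->|x0] := eqVneq x 0.
  by rewrite mul0r vs_val0; split=> // _; [exact: vs0|case: (vs_val y)].
rewrite -[x]/(val (exist _ x x0 : {x : K | x != 0})).
rewrite -[y]/(val (exist _ y y0 : {x : K | x != 0})).
rewrite !vs_valE /= [_ <= _]vs_le_cls; split; [by move/asboolP | by move=> ?; apply/asboolP].
Qed.

Lemma vs_valD x y : leoo (minoo (vs_val x) (vs_val y)) (vs_val (x + y)).
Proof.
wlog h : x y / leoo (vs_val x) (vs_val y).
  move=> H; have : leoo (vs_val x) (vs_val y) || leoo (vs_val y) (vs_val x).
    by case: (vs_val x) (vs_val y) => [a|] [b|] //=; apply: vs_le_total.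
  case/orP => h; first exact: H.
  have := H _ _ h; rewrite addrC /minoo h; case: ifP => // h'.
  by apply: leoo_trans.
rewrite /minoo h; have [x0|x0] := eqVneq x 0.
  move: h; rewrite x0 vs_val0 add0r; by case: (vs_val y).
by apply/(vs_val_le _ x0); rewrite mulrDl divff //; apply: vsD vs1 _; apply/(vs_val_le _ x0).
Qed.

Definition vs_valuation : valuation K := Valuation vs_val_oo vs_valM vs_valD.

Lemma vring_vs_valuation : [set` vring vs_valuation] = W.
Proof.
have e : Some 0 = vs_val 1 by rewrite -[1]/(val nz1) vs_valE.
have E x : (x \in vring vs_valuation) <-> W x.
  by rewrite -[X in W X]divr1 -vs_val_le ?oner_neq0 // -e.
by apply/seteqP; split=> x /E.
Qed.

End ValuationOfSubring.

(* The quotient of [valuation K] by "same valuation ring", realized as the image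
   of nu |-> V_nu: a class is recorded by the common ring of its members.
   [{eq_quot _}] is not available, as [valuation K] quantifies over all value
   groups and so lives in too large a universe to be a [choiceType]. *)
Record ZR (K : fieldType) := MkZR {
  zr_ring : set K;
  zr_ringP : exists nu : valuation K, [set` vring nu] = zr_ring
}.

Section ZariskiRiemann.
Variable K : fieldType.
Implicit Types (x y : ZR K) (E : set (ZR K)).

Definition represents (nu : valuation K) x : Prop := [set` vring nu] = zr_ring x.

(* nu2 = nu1 o nu3, up to equivalence of nu2: V_nu2 is the inverse image of
   V_nu3 in V_nu1. *)
Definition is_composition (nu1 : valuation K) (nu3 : valuation (residue_field nu1))
    (nu2 : valuation K) : Prop :=
  [set` vring nu2] =
  [set val a | a in [set a : vring_type nu1 | residue a \in vring nu3]].

Definition zr_le x y : Prop :=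
  exists (nu1 nu2 : valuation K) (nu3 : valuation (residue_field nu1)),
    [/\ represents nu1 x, represents nu2 y & is_composition nu3 nu2].

Definition trivial_on (k : divringClosed K) (nu : valuation K) : Prop :=
  forall a, a \in k -> a != 0 -> nu a = Some 0.

Definition ZR_over (k : divringClosed K) : set (ZR K) :=
  [set x | exists2 nu, represents nu x & trivial_on k nu].

Definition inf_ring E : set K :=
  smallest (@is_subring K) (\bigcup_(mu in E) zr_ring mu).

Lemma inf_ring_subring E : is_subring (inf_ring E).
Proof.
split=> [A [[]]//|x y hx hy]; split=> A hA; have [[_ hAM] _] := hA;
  by case: (hAM _ _ (hx A hA) (hy A hA)).
Qed.

Lemma vring_inv (nu : valuation K) (x : K) : x \in vring nu \/ x^-1 \in vring nu.
Proof.
rewrite !inE; have [->|x0] := eqVneq x 0; first by left; rewrite val0.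
have [g Eg] := val_neq0 nu x0; have [h Eh] := val_neq0 nu (invr_neq0 x0).
have := vfunM nu x x^-1; rewrite divff // val1 Eg Eh /= => -[] gh.
have /orP[h0|h0] := oag_total 0 g; first by left.
by right; have := oag_le_transl h h0; rewrite addr0 addrC -gh.
Qed.

Lemma inf_ring_inv E : E !=set0 -> forall x : K, inf_ring E x \/ inf_ring E x^-1.
Proof.
move=> [mu Emu] x; have [nu nuE] := zr_ringP mu.
by case: (vring_inv nu x) => h; [left|right] => A [_ hA]; apply: hA;
  exists mu => //; rewrite -nuE.
Qed.

Lemma inf_ring_valuation E : E !=set0 ->
  exists nu : valuation K, [set` vring nu] = inf_ring E.
Proof.
move=> E0.
exists (vs_valuation (ValuationSubring (inf_ring_subring E) (inf_ring_inv E0))).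
exact: vring_vs_valuation.
Qed.

Definition nu_inf E (E0 : E !=set0) : ZR K := MkZR (inf_ring_valuation E0).

End ZariskiRiemann.

Section Semilattice.
Variables (T : Type) (S : set T) (le : T -> T -> Prop).

Definition partial_order_on : Prop :=
  [/\ forall x, S x -> le x x,
      forall x y, S x -> S y -> le x y -> le y x -> x = y
    & forall x y z, S x -> S y -> S z -> le x y -> le y z -> le x z].

Definition is_infimum_on (E : set T) (g : T) : Prop :=
  [/\ S g, forall m, E m -> le g m
    & forall x, S x -> (forall m, E m -> le x m) -> le x g].

(* Despite the name, the bounds required to exist are infima, and of arbitrary
   non-empty subsets. *)
Definition join_semilattice_on : Prop :=
  partial_order_on /\
  forall E : set T, E !=set0 -> E `<=` S -> exists g, is_infimum_on E g.

End Semilattice.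

(* Main.v *)
Require Import Defs.
From mathcomp Require Import all_boot all_order all_algebra.
From mathcomp Require Import boolp classical_sets.

(** The relation [zr_le x y], defined through composite valuations, is reverse
    inclusion of valuation rings: this is [zr_leE]. A composite [nu1 o nu3] has
    its ring inside that of [nu1] by definition. Conversely, if V2 is contained
    in V1, the maximal ideal M1 of V1 lies in V2: a nonzero element of M1 has
    its inverse outside V1, hence outside V2, so it belongs to V2 itself. Thus
    V2 is the full inverse image of V2 / M1, which is a valuation ring of the
    residue field of V1.

    After this translation the universal property of [nu_inf] says that a
    valuation ring contains every ring in a family iff it contains the subring
    they generate, and the order axioms are those of inclusion, because a point
    of [ZR K] is determined by its ring. For totality, if V is contained in V1
    and in V2, with x in V1 but not in V2, then any nonzero y in V2 has
    y / x in V: otherwise x / y would be in V, hence x = (x / y) y in V2. So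
    y = (y / x) x is in V1.

    The relative case reduces to the absolute one through [ZR_overE]: being
    trivial on k means that the valuation ring contains k. This condition passes
    to larger rings, so infima taken in [ZR K] stay in [ZR_over k]. *)

Set Implicit Arguments.
Unset Strict Implicit.
Unset Printing Implicit Defensive.

Import Order.TTheory GRing.Theory.
Local Open Scope ring_scope.
Local Open Scope classical_set_scope.

Section Specialization.
Variables (K : fieldType) (nu1 nu2 : valuation K).
Hypothesis V21 : [set` vring nu2] `<=` [set` vring nu1].

Lemma max_ideal_sub_vring (a : vring_type nu1) :
  a \in @max_ideal K nu1 -> val a \in vring nu2.
Proof.
rewrite max_idealE => /orP[/eqP->|h]; first exact: rpred0.
by case: (vring_inv nu2 (val a)) => // /V21; rewrite /= (negPf h).
Qed.

Definition residue_image : set (residue_field nu1) :=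
  [set residue a | a in [set a : vring_type nu1 | val a \in vring nu2]].

Lemma residue_image_subring : is_subring residue_image.
Proof.
split; first by exists 1; rewrite /= ?rpred1 // /residue rmorph1.
move=> _ _ [a aV <-] [b bV <-]; split.
  by exists (a - b); rewrite /= ?rpredB // /residue rmorphB.
by exists (a * b); rewrite /= ?rpredM // /residue rmorphM.
Qed.

Lemma residue_image_inv q : residue_image q \/ residue_image q^-1.
Proof.
have [aV|aV] := vring_inv nu2 (val (generic_quotient.repr q)).
  left; exists (generic_quotient.repr q) => //.
  exact: generic_quotient.reprK.
right; exists (insubd 0 (val (generic_quotient.repr q))^-1) => //=.
by rewrite insubdK //; apply: V21.
Qed.

Definition residue_valuation : valuation (residue_field nu1) :=
  vs_valuation (ValuationSubring residue_image_subring residue_image_inv).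

Lemma mem_residue_valuation (a : vring_type nu1) :
  (residue a \in vring residue_valuation) = (val a \in vring nu2).
Proof.
have imP : (residue a \in vring residue_valuation) <-> residue_image (residue a).
  have /= <- := vring_vs_valuation
    (ValuationSubring residue_image_subring residue_image_inv).
  by [].
apply/idP/idP => [/imP[b bV ba]|aV]; last by apply/imP; exists a.
(* Equal residues: a and b differ by an element of the maximal ideal. *)
rewrite -(subrK b a) rmorphD; apply: rpredD => //.
apply: max_ideal_sub_vring; rewrite -residue_eq0 /residue rmorphB subr_eq0.
by apply/eqP; apply: (esym ba).
Qed.

Lemma residue_valuation_composition : is_composition residue_valuation nu2.
Proof.
apply/seteqP; split=> [x xV2|_ [a aV <-]]; last first.
  by move: aV; rewrite /= mem_residue_valuation.
exists (VringType (V21 xV2)) => //.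
by rewrite /= mem_residue_valuation.
Qed.

End Specialization.

Section ZROrder.
Variable K : fieldType.
Implicit Types (x y z : ZR K) (E S : set (ZR K)).

Lemma ZR_ext x y : zr_ring x = zr_ring y -> x = y.
Proof.
case: x y => [A pA] [B pB] /= AB; subst B.
by rewrite (Prop_irrelevance pA pB).
Qed.

Lemma zr_leE x y : zr_le x y <-> zr_ring y `<=` zr_ring x.
Proof.
split=> [[nu1 [nu2 [nu3 [<- <- ->]]]]|].
  by move=> _ [a _ <-]; apply: (valP a).
have [nu1 r1] := zr_ringP x; have [nu2 r2] := zr_ringP y.
rewrite -r1 -r2 => V21; exists nu1, nu2, (residue_valuation V21).
by split=> //; apply: residue_valuation_composition.
Qed.

Lemma zr_ring_subring x : is_subring (zr_ring x).
Proof.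
have [nu <-] := zr_ringP x.
by split=> [|a b aV bV]; [exact: rpred1 | split; [exact: rpredB | exact: rpredM]].
Qed.

Lemma zr_ring0 x : zr_ring x 0.
Proof.
by have [x1 h] := zr_ring_subring x; case: (h _ _ x1 x1); rewrite subrr.
Qed.

Lemma zr_ringM x a b : zr_ring x a -> zr_ring x b -> zr_ring x (a * b).
Proof. by have [_ h] := zr_ring_subring x => ha hb; case: (h _ _ ha hb). Qed.

Lemma zr_ring_inv x a : zr_ring x a \/ zr_ring x a^-1.
Proof. by have [nu <-] := zr_ringP x; apply: vring_inv. Qed.

Lemma zr_le_inf E (E0 : E !=set0) x :
  (forall m, E m -> zr_le x m) <-> zr_le x (nu_inf E0).
Proof.
rewrite zr_leE; split=> [xE a|xinf m Em].
  by apply; split=> [|b [m /xE/zr_leE]]; [exact: zr_ring_subring | apply].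
by apply/zr_leE => a am; apply: xinf => A [_ EA]; apply: EA; exists m.
Qed.

Lemma zr_le_total_below z x y : zr_le x z -> zr_le y z -> zr_le x y \/ zr_le y x.
Proof.
move=> /zr_leE zx /zr_leE zy; have [|] := pselect (zr_ring x `<=` zr_ring y).
  by move=> xy; right; apply/zr_leE.
move=> /existsNP[a /not_implyP[ax ay]]; left; apply/zr_leE => b yb.
have [->|b0] := eqVneq b 0; first exact: zr_ring0.
have a0 : a != 0 by apply: contra_notN ay => /eqP->; apply: zr_ring0.
case: (zr_ring_inv z (b / a)) => [/zx bax|].
  by rewrite -(divfK a0 b); apply: zr_ringM.
by rewrite invf_div => /zy aby; case: ay; rewrite -(divfK b0 a); apply: zr_ringM.
Qed.

(** Stated for a subset S so that it covers both [ZR K] and [ZR_over k]: the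
    infimum in S is the one of [ZR K], which only has to belong to S. *)
Lemma zr_join_semilattice S :
    (forall E (E0 : E !=set0), E `<=` S -> S (nu_inf E0)) ->
  join_semilattice_on S (@zr_le K).
Proof.
move=> Sinf; split; first split.
- by move=> x _; apply/zr_leE.
- by move=> x y _ _ /zr_leE yx /zr_leE xy; apply/ZR_ext/seteqP.
- move=> x y z _ _ _ /zr_leE yx /zr_leE zy; apply/zr_leE.
  exact: subset_trans zy yx.
move=> E E0 ES; exists (nu_inf E0); split; first exact: Sinf.
  by apply/(zr_le_inf E0)/zr_leE.
by move=> x _ /(zr_le_inf E0).
Qed.

Lemma trivial_onE (k : divringClosed K) (nu : valuation K) :
  trivial_on k nu <-> [set` k] `<=` [set` vring nu].
Proof.
split=> [kT a ak|kV a ak a0].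
  rewrite /= inE; have [->|a0] := eqVneq a 0; first by rewrite val0.
  by rewrite kT //= lexx.
(* Both a and its inverse lie in the ring, so 0 <= nu a <= 0. *)
have := kV _ ak; have /kV : a^-1 \in k by rewrite rpredV.
rewrite /= !inE; have := vfunM nu a a^-1; rewrite divff // Defs.val1.
case: (nu a) => [g|] //; case: (nu a^-1) => [h|] //= [gh] h0 g0.
congr Some; apply/le_anti; rewrite g0 andbT gh.
by have := oag_le_transl g h0; rewrite addr0.
Qed.

Lemma ZR_overE (k : divringClosed K) x : ZR_over k x <-> [set` k] `<=` zr_ring x.
Proof.
split=> [[nu <- /trivial_onE]//|]; have [nu nuE] := zr_ringP x.
by rewrite -nuE => /trivial_onE; exists nu.
Qed.

Lemma nu_inf_over (k : divringClosed K) E (E0 : E !=set0) :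
  E `<=` ZR_over k -> ZR_over k (nu_inf E0).
Proof.
move=> Ek; have [m Em] := E0; have /ZR_overE km := Ek _ Em.
by apply/ZR_overE => a /km am A [_ EA]; apply: EA; exists m.
Qed.

End ZROrder.

Theorem proposition4p27 (K : fieldType) :
  [/\ (forall (E : set (ZR K)) (E0 : E !=set0) (nu : ZR K),
         (forall mu, E mu -> zr_le nu mu) <-> zr_le nu (nu_inf E0)),
      join_semilattice_on [set: ZR K] (@zr_le K)
    & forall nu : ZR K, total_on [set mu | zr_le mu nu] (@zr_le K)]
  /\
  (forall k : divringClosed K,
   [/\ (forall (E : set (ZR K)) (E0 : E !=set0), E `<=` ZR_over k ->
          ZR_over k (nu_inf E0) /\
          forall nu, ZR_over k nu ->
            (forall mu, E mu -> zr_le nu mu) <-> zr_le nu (nu_inf E0)),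
       join_semilattice_on (ZR_over k) (@zr_le K)
     & forall nu, ZR_over k nu ->
         total_on [set mu | ZR_over k mu /\ zr_le mu nu] (@zr_le K)]).
Proof.
split=> [|k]; split.
- exact: zr_le_inf.
- exact: zr_join_semilattice.
- by move=> nu x y; apply: zr_le_total_below.
- move=> E E0 Ek; split; first exact: nu_inf_over.
  by move=> nu _; apply: zr_le_inf.
- by apply: zr_join_semilattice => E E0; apply: nu_inf_over.
- by move=> nu _ x y [_ xnu] [_ ynu]; apply: zr_le_total_below xnu ynu.
Qed.
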